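(* Let $K\subseteq\mathbb{R}^n$ be nonempty, closed and convex, let $f=(f_1,\dots,f_m):K\to\mathbb{R}^m$ be continuous, and let $f_1,\dots,f_m$ be quasi-convex on $K$ and bounded from below by $0$ on $K$ (i.e. $f_i(x)\ge 0$ for all $x\in K$ and all $i$). Let $\mathcal{O}_2=\{\xi\in\operatorname{dom}\Theta_2:\Theta_2(\xi)\text{ is bounded}\}$. Assume that one of the following conditions holds: (a) $\operatorname{dom}\Theta_2$ is connected; (b) $\mathcal{O}_2$ is open in $\Delta$. If the weak Pareto solution set $\operatorname{Sol}^w(K,f)$ is disconnected, then all its connected components are unbounded. Consequently, if $\operatorname{Sol}^w(K,f)$ is bounded, then it is connected.
   Context: $\Delta=\{(\xi_1,\dots,\xi_m)\in\mathbb{R}^m_+:\xi_1+\dots+\xi_m=1\}$. For $\xi\in\Delta$, $f^\xi(x)=\max\{\xi_1f_1(x),\dots,\xi_mf_m(x)\}$, and $\Theta_2(\xi)$ is the set of global minimizers of $f^\xi$ over $K$. $\operatorname{dom}\Theta_2=\{\xi\in\Delta:\Theta_2(\xi)\neq\emptyset\}$. A point $x\in K$ is a weak Pareto solution (an element of $\operatorname{Sol}^w(K,f)$) if there is no $y\in K$ with $f(y)-f(x)\in-\operatorname{int}\mathbb{R}^m_+$. A function $g:K\to\mathbb{R}$ is quasi-convex on $K$ if $g(tx+(1-t)y)\le\max\{g(x),g(y)\}$ for all $x\neq y$ in $K$ and $t\in(0,1)$. *)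

(* Defs.v *)
From mathcomp Require Import all_boot all_order all_algebra.
From mathcomp Require Import all_classical all_reals all_analysis.

Set Implicit Arguments.
Unset Strict Implicit.
Unset Printing Implicit Defensive.

Import Order.TTheory GRing.Theory Num.Theory.
Import numFieldNormedType.Exports.

Local Open Scope classical_set_scope.
Local Open Scope ring_scope.

Section Definitions.
Context {R : realType} {n m : nat}.

(* A function K -> R^(m+1) is represented by a total function on 'rV[R]_n;
   every definition below only uses its values on K. *)
Implicit Types (K : set 'rV[R]_n) (f : 'rV[R]_n -> 'rV[R]_m.+1).

Definition nonneg_orthant : set 'rV[R]_m.+1 :=
  [set v | forall i, 0 <= v ord0 i].

Definition simplex : set 'rV[R]_m.+1 :=
  [set xi | nonneg_orthant xi /\ \sum_i xi ord0 i = 1].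

Definition quasi_convex_on K (g : 'rV[R]_n -> R) :=
  forall x y t, K x -> K y -> x != y -> 0 < t -> t < 1 ->
    g (t *: x + (1 - t) *: y) <= Num.max (g x) (g y).

(* The seed of the iterated maximum is one of its own terms, so this is the
   true maximum whatever the signs of the terms. *)
Definition weighted_max f (xi : 'rV[R]_m.+1) (x : 'rV[R]_n) : R :=
  \big[Num.max/xi ord0 ord0 * f x ord0 ord0]_(i < m.+1)
    (xi ord0 i * f x ord0 i).

Definition global_minimizers K (g : 'rV[R]_n -> R) : set 'rV[R]_n :=
  [set x | K x /\ forall y, K y -> g x <= g y].

Definition Theta2 K f (xi : 'rV[R]_m.+1) : set 'rV[R]_n :=
  global_minimizers K (weighted_max f xi).

Definition dom_Theta2 K f : set 'rV[R]_m.+1 :=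
  [set xi | simplex xi /\ Theta2 K f xi !=set0].

Definition O2 K f : set 'rV[R]_m.+1 :=
  [set xi | dom_Theta2 K f xi /\ bounded_set (Theta2 K f xi)].

Definition weak_pareto K f : set 'rV[R]_n :=
  [set x | K x /\
    ~ exists2 y, K y & (-%R @` (nonneg_orthant°)) (f y - f x)].

End Definitions.

(* Main.v *)
Require Import Defs.
From mathcomp Require Import all_boot all_order all_algebra.
From mathcomp Require Import all_classical all_reals all_analysis.
From mathcomp Require Import lra.

Set Implicit Arguments.
Unset Strict Implicit.
Unset Printing Implicit Defensive.

Import Order.TTheory GRing.Theory Num.Theory.
Import numFieldNormedType.Exports.

Local Open Scope classical_set_scope.
Local Open Scope ring_scope.

(** A weak Pareto solution is the same thing as a minimizer over [K] of some
    weighted maximum f^xi with weights xi in the simplex: if all f_i(x) are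
    positive, weights proportional to 1 / f_i(x) make all the terms of the
    maximum equal at x, and if f_i(x) = 0 then x minimizes f_i, hence f^xi for
    xi the i-th vertex ([weak_pareto_Theta2], [Theta2_weak_pareto]).  Since
    f^xi is quasi-convex, each Theta2(xi) is convex, so it lies in a single
    connected component of the weak Pareto set.

    Let C be a bounded component.  The weak Pareto set is closed, so C is
    compact.  Let A be the set of the weights xi such that Theta2(xi) meets C;
    then Theta2(xi) is nonempty and contained in C for every xi in A.  The idea
    is that A is open and closed in the simplex, which is connected; hence A is
    the whole simplex, every Theta2(xi) lies in C, and the weak Pareto set is
    equal to C, so it is connected.

    A is closed because C is compact and being a minimizer is a closed
    condition on the pair (xi, x) ([Theta2_avoids_near]).

    A is open because of quasi-convexity.  If Theta2(xi) is nonempty and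
    contained in an open ball, then f^xi exceeds its minimum on the bounding
    sphere.  The sphere being compact, for xi' near xi the function f^xi' is
    still larger on the sphere than at a fixed point inside, and
    quasi-convexity along segments propagates this to everything outside the
    ball ([quasi_convex_lt_outside]).  So Theta2(xi') is nonempty and stays in
    the ball ([Theta2_bounded_near]), and Theta2 is upper semicontinuous at xi
    ([Theta2_usc]).  The union of the Theta2(xi') over a small convex
    neighbourhood of xi in A is then connected, as the image of a connected set
    under an upper semicontinuous map with connected values
    ([connected_bigcup_usc]); it meets C, so it is contained in C. *)

(** * Convexity and connectedness *)

(** Exchanges the bundled coefficient of the convex structure for a scalar
    with bounds, which is the form produced by segments. *)
Lemma convex_setP (R : numDomainType) (V : lmodType R) (A : set V) :
  convex_set (A : set (convex_lmodType V)) <->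
  forall x y t, A x -> A y -> 0 <= t <= 1 -> A (t *: x + (1 - t) *: y).
Proof.
split=> [cA x y t Ax Ay t01|cA x y l /set_mem Ax /set_mem Ay].
  have t_i01 : Itv.spec (@Itv.num_sem R) (Itv.Real `[0%Z, 1%Z]) t.
    by rewrite /= /Itv.num_sem in_itv/= mulr1z mulr0z t01 andbT ger0_real//;
      case/andP: t01.
  have := cA x y (Itv.mk t_i01) (mem_set Ax) (mem_set Ay).
  by move/set_mem.
by apply/mem_set/cA => //; apply/andP; split.
Qed.

Lemma ball_convex (R : realType) (V : normedModType R) (c : V) (e : R) :
  convex_set (ball c e : set (convex_lmodType V)).
Proof.
apply/convex_setP => x y t; rewrite -ball_normE /= => cx cy /andP[t0 t1].
have -> : c - (t *: x + (1 - t) *: y) = t *: (c - x) + (1 - t) *: (c - y).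
  rewrite !scalerBr addrACA -scalerDl [t + _]addrC subrK scale1r.
  by rewrite opprD.
apply: le_lt_trans (ler_normD _ _) _; rewrite !normrZ.
have u0 : 0 <= 1 - t by rewrite subr_ge0.
rewrite (ger0_norm t0) (ger0_norm u0).
have [->|tn0] := eqVneq t 0; first by rewrite mul0r add0r subr0 mul1r.
have tp : 0 < t by rewrite lt_neqAle eq_sym tn0.
have h1 : t * `|c - x| < t * e by rewrite ltr_pM2l.
have h2 : (1 - t) * `|c - y| <= (1 - t) * e by rewrite ler_wpM2l// ltW.
apply: lt_le_trans (ltr_leD h1 h2) _.
by rewrite -mulrDl [t + _]addrC subrK mul1r.
Qed.

Lemma convex_setI (R : numDomainType) (V : lmodType R) (A B : set V) :
  convex_set (A : set (convex_lmodType V)) ->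
  convex_set (B : set (convex_lmodType V)) ->
  convex_set (A `&` B : set (convex_lmodType V)).
Proof.
move=> /convex_setP cA /convex_setP cB; apply/convex_setP.
by move=> x y t [Ax Bx] [Ay By] t01; split; [exact: cA|exact: cB].
Qed.

(** The set is the union of the segments joining its points to a fixed one. *)
Lemma convex_connected (R : realType) (V : normedModType R) (A : set V) :
  convex_set (A : set (convex_lmodType V)) -> connected A.
Proof.
move=> /convex_setP cA.
have [->|/set0P[a Aa]] := eqVneq A set0; first exact: connected0.
pose seg y := (fun t : R => t *: y + (1 - t) *: a) @` `[0, 1].
have -> : A = \bigcup_(y in A) seg y.
  apply/seteqP; split=> [y Ay|z [y Ay [t t01 <-]]].
    exists y => //; exists 1; first by rewrite /= in_itv/= ler01 lexx.
    by rewrite scale1r subrr scale0r addr0.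
  by apply: cA => //; move: t01; rewrite /= in_itv.
apply: bigcup_connected.
  exists a => y Ay; exists 0; first by rewrite /= in_itv/= ler01 lexx.
  by rewrite scale0r subr0 scale1r add0r.
move=> y Ay; apply: connected_continuous_connected.
  exact: segment_connected.
apply: continuous_subspaceT => t.
apply: cvgD; apply: cvgZr_tmp; first exact: cvg_id.
by apply: cvgB; [exact: cvg_cst|exact: cvg_id].
Qed.

(** Upper semicontinuous images of connected sets are connected: in a
    separation of the union into two parts, each connected value lies in one
    part, and semicontinuity makes the two corresponding sets of parameters
    relatively open, so they would separate the set of parameters. *)
Lemma connected_bigcup_usc (T U : topologicalType) (N : set T)
    (F : T -> set U) :
  connected N ->
  (forall t, N t -> F t !=set0 /\ connected (F t)) ->
  (forall t W, N t -> open W -> F t `<=` W ->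
     \forall s \near within N (nbhs t), F s `<=` W) ->
  connected (\bigcup_(t in N) F t).
Proof.
move=> Nconn Fconn Fusc; apply/connectedP => E [E0 UE Esep].
have FE t : N t -> F t `<=` E false \/ F t `<=` E true.
  move=> Nt; apply: connected_subset Esep _ (Fconn t Nt).2.
  by rewrite -UE => u Ftu; exists t.
pose P b := [set t | N t -> F t `<=` E b].
have Eopen b t : N t -> F t `<=` E b -> (P b)° t.
  move=> Nt Ftb.
  (* Semicontinuity needs an open set: the complement of the closure of the
     other part. *)
  have Wsep : F t `<=` ~` closure (E (~~ b)).
    move=> u Ftu clu; have Ebu := Ftb _ Ftu.
    case: Esep => s1 s2; case: b Ftb clu Ebu => /= Ftb clu Ebu.
      by have : (closure (E false) `&` E true) u by []; rewrite s1.
    by have : (E false `&` closure (E true)) u by []; rewrite s2.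
  have Wo : open (~` closure (E (~~ b))).
    by rewrite openC; exact: closed_closure.
  have Fnear : nbhs t [set s | N s -> F s `<=` ~` closure (E (~~ b))].
    exact: Fusc Wsep.
  apply: filterS Fnear => s Fs Ns u Fsu.
  have nEu : ~ E (~~ b) u by move=> /subset_closure; exact: Fs Ns u Fsu.
  by case: (FE s Ns) => /(_ u Fsu); case: b nEu {Ftb Wsep Wo Fs}.
have disj t : N t -> F t `<=` E false -> F t `<=` E true -> False.
  move=> Nt s1 s2; have [[u Fu] _] := Fconn t Nt.
  have := separated_disjoint Esep.
  by rewrite predeqE => /(_ u)[+ _]; apply; split; [exact: s1|exact: s2].
have PN b t : N t -> (P b)° t -> F t `<=` E b.
  by move=> Nt /interior_subset; exact.
have wit b : exists2 t, N t & F t `<=` E b.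
  have [u Ebu] := E0 b.
  have [t Nt Ftu] : (\bigcup_(t in N) F t) u.
    by rewrite UE; case: b Ebu; [right|left].
  exists t => //.
  have contra : ~ E (~~ b) u.
    have := separated_disjoint Esep; rewrite predeqE => /(_ u)[+ _].
    by case: b Ebu => /= Eb h Enb; apply: h.
  by case: (FE t Nt) => Ft; case: b Ebu contra => //= Ebu []; exact: Ft.
have clopenN : N `&` (P false)° = N.
  apply: Nconn.
  - by have [t Nt Ft] := wit false; exists t; split=> //; exact: Eopen.
  - by exists (P false)° => //; exact: open_interior.
  - exists (~` (P true)°); first by rewrite closedC; exact: open_interior.
    apply/seteqP; split=> t [Nt Pt]; split=> //.
      by move=> /(PN _ _ Nt); apply: disj => //; exact: PN.
    by case: (FE t Nt) => // Ft; [exact: Eopen|case: Pt; exact: Eopen].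
have [t Nt Ft] := wit true.
have [_ /(PN _ _ Nt)] : (N `&` (P false)°) t by rewrite clopenN.
by move=> Ft'; exact: (disj t).
Qed.

(** * Minimizers of quasi-convex functions *)

Lemma norm_le_bounded (R : realType) (V : normedModType R) (A : set V) r :
  A `<=` [set x | `|x| <= r] -> bounded_set A.
Proof.
move=> Ar; exists r; split=> [|M rM x /Ar /= xr]; first exact: num_real.
exact: le_trans xr (ltW rM).
Qed.

Lemma bounded_subset (R : realType) (V : normedModType R) (A B : set V) :
  A `<=` B -> bounded_set B -> bounded_set A.
Proof.
move=> AB /ex_strict_bound_gt0[r _ Br].
by apply: (@norm_le_bounded _ _ _ r) => x /AB /Br /ltW.
Qed.

Lemma compact_norm_preimage (R : realType) (n : nat) (K : set 'rV[R]_n)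
    (S : set R) (r : R) :
  closed K -> closed S -> S `<=` [set t | t <= r] ->
  compact (K `&` [set x | S `|x|]).
Proof.
move=> clK clS Sr; apply: bounded_closed_compact.
  by apply: (@norm_le_bounded _ _ _ r) => x [_ /Sr].
apply: closedI => //.
rewrite -[[set x | _]]/((fun x : 'rV[R]_n => `|x|) @^-1` S).
by apply: closed_comp => // x _; exact: norm_continuous.
Qed.

Lemma global_minimizers_convex (R : realType) (n : nat) (K : set 'rV[R]_n)
    (g : 'rV[R]_n -> R) :
  convex_set (K : set (convex_lmodType 'rV[R]_n)) -> quasi_convex_on K g ->
  convex_set (global_minimizers K g : set (convex_lmodType 'rV[R]_n)).
Proof.
move=> /convex_setP cK qg; apply/convex_setW => x y.
move=> /set_mem[Kx xmin] /set_mem[Ky ymin] t t0 t1; apply/mem_set.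
have Kz : K (t%:num *: x + (1 - t%:num) *: y).
  by apply: cK => //; rewrite !ltW.
split=> // z Kz'; have [xy|xy] := eqVneq x y.
  suff -> : conv t x y = x by exact: xmin.
  by rewrite xy convmm.
apply: (le_trans (qg x y _ Kx Ky xy t0 t1)).
by rewrite ge_max xmin ?ymin.
Qed.

(** The segment from [x] to [y] crosses the sphere at some [z]; as
    [g x < g z <= max (g y) (g x)], the maximum is reached at [y]. *)
Lemma quasi_convex_lt_outside (R : realType) (n : nat) (K : set 'rV[R]_n)
    (g : 'rV[R]_n -> R) (x y : 'rV[R]_n) (r : R) :
  convex_set (K : set (convex_lmodType 'rV[R]_n)) -> quasi_convex_on K g ->
  K x -> `|x| < r -> (forall z, K z -> `|z| = r -> g x < g z) ->
  K y -> r < `|y| -> g x < g y.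
Proof.
move=> /convex_setP cK qg Kx xr sphere Ky ry.
pose h (t : R) : R := `|t *: y + (1 - t) *: x|.
have h0 : h 0 = `|x| by rewrite /h scale0r subr0 scale1r add0r.
have h1 : h 1 = `|y| by rewrite /h scale1r subrr scale0r addr0.
have hcont : continuous h.
  move=> t; apply: cvg_norm; apply: cvgD; apply: cvgZr_tmp; first exact: cvg_id.
  by apply: cvgB; [exact: cvg_cst|exact: cvg_id].
have [|t] := @IVT R h 0 1 r ler01 (continuous_subspaceT hcont).
  by rewrite h0 h1 ge_min le_max (ltW xr) (ltW ry) orbT.
rewrite in_itv/= => /andP[t0 t1] htr.
have {}t0 : 0 < t.
  rewrite lt_neqAle t0 andbT; apply/eqP => t0'.
  by move: xr; rewrite -htr -t0' h0 ltxx.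
have {}t1 : t < 1.
  rewrite lt_neqAle t1 andbT; apply/eqP => t1'.
  by move: ry; rewrite -htr t1' h1 ltxx.
have yx : y != x by apply: contraTneq ry => ->; rewrite -leNgt ltW.
have Kz : K (t *: y + (1 - t) *: x) by apply: cK => //; rewrite !ltW.
have gxz := sphere _ Kz htr.
have := lt_le_trans gxz (qg y x t Ky Kx yx t0 t1).
by rewrite lt_max ltxx orbF.
Qed.

(** Outside the ball [g] is larger than at [x], so that its minimum over the
    compact part of [K] in the closed ball is a minimum over [K]. *)
Lemma global_minimizers_in_ball (R : realType) (n : nat) (K : set 'rV[R]_n)
    (g : 'rV[R]_n -> R) (x : 'rV[R]_n) (r : R) :
  closed K -> convex_set (K : set (convex_lmodType 'rV[R]_n)) ->
  {within K, continuous g} -> quasi_convex_on K g ->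
  K x -> `|x| < r -> (forall z, K z -> `|z| = r -> g x < g z) ->
  global_minimizers K g !=set0 /\
  global_minimizers K g `<=` [set y | `|y| <= r].
Proof.
move=> clK cK gcont qg Kx xr sphere.
have outside y : K y -> r < `|y| -> g x < g y.
  exact: (quasi_convex_lt_outside cK qg Kx xr sphere).
split; last first.
  move=> y [Ky ymin] /=; rewrite leNgt; apply/negP => /(outside _ Ky).
  by rewrite ltNge ymin.
pose D := K `&` [set y | `|y| <= r].
have Dcompact : compact D.
  by apply: (@compact_norm_preimage _ _ _ _ r clK (@closed_le _ r)).
have Dx : D x by split=> //=; exact: ltW.
have DK : D `<=` K by move=> ? [].
have [z /set_mem[Kz zr] zmin] := EVT_min_rV (ex_intro _ x Dx) Dcompact
  (continuous_subspaceW DK gcont).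
exists z; split=> // y Ky; have [yr|yr] := leP `|y| r.
  by apply: zmin; apply/mem_set.
by apply: le_trans (ltW (outside y Ky yr)); apply: zmin; exact/mem_set.
Qed.

(** * The weighted maximum *)

Lemma simplex_convex (R : realType) (m : nat) :
  convex_set (@simplex R m : set (convex_lmodType 'rV[R]_m.+1)).
Proof.
apply/convex_setP => x y t [x0 x1] [y0 y1] /andP[t0 t1]; split=> [i|].
  by rewrite !mxE addr_ge0// mulr_ge0 ?subr_ge0//.
under eq_bigr do rewrite !mxE.
by rewrite big_split/= -!mulr_sumr x1 y1 !mulr1 addrC subrK.
Qed.

Section WeightedMax.
Context (R : realType) (n m : nat).
Implicit Types (K : set 'rV[R]_n) (f : 'rV[R]_n -> 'rV[R]_m.+1)
  (xi : 'rV[R]_m.+1).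

Lemma weighted_max_leP f xi x c :
  weighted_max f xi x <= c <-> forall i, xi ord0 i * f x ord0 i <= c.
Proof.
split=> [/bigmax_leP[_ h] i|h]; first exact: h.
by apply/bigmax_leP; split=> [|i _]; exact: h.
Qed.

Lemma weighted_max_ltP f xi x c :
  weighted_max f xi x < c <-> forall i, xi ord0 i * f x ord0 i < c.
Proof.
split=> [/bigmax_ltP[_ h] i|h]; first exact: h.
by apply/bigmax_ltP; split=> [|i _]; exact: h.
Qed.

Lemma le_weighted_max f xi x i :
  xi ord0 i * f x ord0 i <= weighted_max f xi x.
Proof. exact: le_bigmax. Qed.

Lemma weighted_max_quasi_convex K f xi :
  nonneg_orthant xi ->
  (forall i, quasi_convex_on K (fun x => f x ord0 i)) ->
  quasi_convex_on K (weighted_max f xi).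
Proof.
move=> xi0 qf x y t Kx Ky xy t0 t1; apply/weighted_max_leP => i.
apply: (le_trans (ler_wpM2l (xi0 i) (qf i x y t Kx Ky xy t0 t1))).
by rewrite maxr_pMr// ge_max !le_max !le_weighted_max orbT.
Qed.

(** The filter is restricted to [K] in the second factor because nothing is
    known of [f] outside [K]. *)
Lemma weighted_max_cvg K f xi x :
  {within K, continuous f} -> K x ->
  weighted_max f p.1 p.2 @[p --> (nbhs xi, within K (nbhs x))] -->
    weighted_max f xi x.
Proof.
move=> /subspace_continuousP fcont Kx.
have term i : (p.1 : 'rV[R]_m.+1) ord0 i * f p.2 ord0 i
    @[p --> (nbhs xi, within K (nbhs x))] --> xi ord0 i * f x ord0 i.
  apply: cvgM.
    apply: (@cvg_comp _ _ _ fst (fun v : 'rV[R]_m.+1 => v ord0 i) _ (nbhs xi)).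
      exact: cvg_fst.
    exact: coord_continuous.
  apply: (@cvg_comp _ _ _ (f \o snd) (fun v : 'rV[R]_m.+1 => v ord0 i) _
    (nbhs (f x))); last exact: coord_continuous.
  apply: (@cvg_comp _ _ _ snd f _ (within K (nbhs x))); first exact: cvg_snd.
  exact: fcont.
rewrite /weighted_max; elim: (index_enum _) => [|i s IH].
  by rewrite big_nil; under eq_fun do rewrite big_nil; exact: term.
rewrite big_cons; under eq_fun do rewrite big_cons.
apply: continuous2_cvg (term i) IH.
exact: (@max_continuous _ R (_, _)).
Qed.

Lemma weighted_max_within_continuous K f xi :
  {within K, continuous f} -> {within K, continuous (weighted_max f xi)}.
Proof.
move=> fcont; apply/subspace_continuousP => x Kx.
apply: (cvg_comp (fun y => (xi, y)) (fun p => weighted_max f p.1 p.2));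
  last exact: weighted_max_cvg fcont Kx.
by apply: cvg_pair; [exact: cvg_cst|exact: cvg_id].
Qed.

(** A strict inequality at [(xi, x)] persists nearby.  This is the open
    condition to which compactness is applied below, both to keep minimizers
    away from a compact set and to keep f^xi large on a sphere. *)
Lemma weighted_max_lt_near K f xi x y :
  {within K, continuous f} -> K x -> K y ->
  weighted_max f xi y < weighted_max f xi x ->
  \forall x' \near x & xi' \near xi,
    K x' -> weighted_max f xi' y < weighted_max f xi' x'.
Proof.
move=> fcont Kx Ky yx.
pose c := (weighted_max f xi y + weighted_max f xi x) / 2.
(* Both values are separated by the midpoint c, the right one in a neighbourhood
   of (xi, x) and the left one in a neighbourhood of xi. *)
have near_x := cvgr_gt _ (weighted_max_cvg fcont Kx) _ (midf_lt yx).2.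
have near_y := cvgr_lt _ (weighted_max_cvg fcont Ky) _ (midf_lt yx).1.
case: near_x => -[A B] /= [nA nB] AB.
case: near_y => -[A' B'] /= [nA' nB'] AB'.
exists ([set x' | K x' -> B x'], A `&` A') => /=.
  by split=> //; exact: filterI.
move=> -[x' xi'] /= [Bx' [Axi Axi']] Kx'.
apply: (@lt_trans _ _ c).
  by apply: (AB' (xi', y)); split=> //=; exact: (nbhs_singleton nB').
by apply: (AB (xi', x')); split=> //; exact: Bx'.
Qed.

End WeightedMax.

(** * Weak Pareto solutions as minimizers of weighted maxima *)

Lemma interior_nonneg_orthant (R : realType) (m : nat) :
  (@nonneg_orthant R m)° = [set v | forall i, 0 < v ord0 i].
Proof.
apply/seteqP; split=> [v /nbhs_ballP[e /= e0 ev] i|v v0].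
  have e20 : 0 < e / 2 by rewrite divr_gt0.
  have /ev/(_ i) : ball v e (v - const_mx (e / 2)).
    split=> // j k; rewrite -ball_normE /= !mxE opprB addrC subrK.
    by rewrite gtr0_norm// ltr_pdivrMr// mulr_natr mulr2n ltrDl.
  by rewrite !mxE subr_ge0; exact: lt_le_trans.
have v_near i : \forall w \near v, 0 < (w : 'rV[R]_m.+1) ord0 i.
  exact: (cvgr_gt _ (@coord_continuous _ _ _ ord0 i v) _ (v0 i)).
have := filter_forall (nbhs_filter v) v_near.
by apply: filterS => w w0 i; exact: ltW.
Qed.

Section WeakPareto.
Context (R : realType) (n m : nat).
Implicit Types (K : set 'rV[R]_n) (f : 'rV[R]_n -> 'rV[R]_m.+1)
  (xi : 'rV[R]_m.+1).

Lemma weak_paretoP K f x : weak_pareto K f x <->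
  K x /\ ~ exists2 y, K y & forall i, f y ord0 i < f x ord0 i.
Proof.
rewrite /weak_pareto interior_nonneg_orthant /=.
split=> -[Kx nP]; split=> //; apply: contra_not nP => -[y Ky yx];
  exists y => //.
  by exists (f x - f y); [move=> i; rewrite !mxE subr_gt0|rewrite opprB].
move=> i; case: yx => v /(_ i) v0 fv.
by move/matrixP/(_ ord0 i): fv; rewrite !mxE => fv; lra.
Qed.

Lemma closed_weak_pareto K f :
  closed K -> {within K, continuous f} -> closed (weak_pareto K f).
Proof.
move=> clK /subspace_continuousP fcont x clx.
have Kx : K x by apply: clK; apply: closure_subset clx => ? [].
apply/weak_paretoP; split=> // -[y Ky yx].
have x_near i : \forall z \near within K (nbhs x), f y ord0 i < f z ord0 i.
  apply: cvgr_gt (yx i).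
  apply: (cvg_comp f (fun v : 'rV[R]_m.+1 => v ord0 i) (fcont x Kx)).
  exact: coord_continuous.
have near_x := filter_forall (within_filter K (nbhs_filter x)) x_near.
have [z [/weak_paretoP[Kz nz] zx]] := clx _ near_x.
by apply: nz; exists y => //; exact: zx.
Qed.

(** If [y] were strictly better than [x] in all objectives, each term
    of the maximum with a positive weight would decrease strictly; the terms
    with weight zero do not matter, because the maximum at [x] is positive. *)
Lemma Theta2_weak_pareto K f xi x :
  (forall i x, K x -> 0 <= f x ord0 i) -> simplex xi ->
  Theta2 K f xi x -> weak_pareto K f x.
Proof.
move=> f0 [xi0 xi1] [Kx xmin]; apply/weak_paretoP; split=> // -[y Ky yx].
have : weighted_max f xi y < weighted_max f xi x; last by rewrite ltNge xmin.
have fx0 i : 0 < f x ord0 i by exact: le_lt_trans (f0 i y Ky) (yx i).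
apply/weighted_max_ltP => i.
have := xi0 i; rewrite le_eqVlt => /predU1P[<-|xii]; last first.
  by apply: lt_le_trans (le_weighted_max f xi x i); rewrite ltr_pM2l.
have [j xij] : exists j, 0 < xi ord0 j.
  apply: contrapT => /forallNP h; have : \sum_j xi ord0 j = 0.
    rewrite big1// => j _; apply/eqP; rewrite eq_le xi0 andbT leNgt.
    exact/negP/h.
  by rewrite xi1 => /eqP; rewrite oner_eq0.
rewrite mul0r; apply: lt_le_trans (le_weighted_max f xi x j).
by rewrite mulr_gt0.
Qed.

(** The weights are a vertex of the simplex if an objective vanishes at [x],
    and otherwise they are proportional to the inverses of the objectives, which
    equalizes the terms of the maximum at [x]. *)
Lemma weak_pareto_Theta2 K f x :
  (forall i x, K x -> 0 <= f x ord0 i) ->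
  weak_pareto K f x -> exists2 xi, simplex xi & Theta2 K f xi x.
Proof.
move=> f0 /weak_paretoP[Kx nx].
have [[i fxi]|/forallNP fx_neq0] := pselect (exists i, f x ord0 i = 0).
  pose xi : 'rV[R]_m.+1 := delta_mx ord0 i.
  have xiE j : xi ord0 j = (j == i)%:R by rewrite mxE eqxx.
  exists xi.
    split=> [j|]; first by rewrite xiE.
    rewrite (bigD1 i)//= xiE eqxx big1 ?addr0// => j /negPf ji.
    by rewrite xiE ji.
  split=> // y Ky; apply/weighted_max_leP => j.
  have -> : xi ord0 j * f x ord0 j = 0.
    by rewrite xiE; have [->|] := eqVneq; rewrite ?mul0r// fxi mulr0.
  apply: le_trans (le_weighted_max f xi y i).
  by rewrite xiE eqxx mul1r f0.
have fx0 i : 0 < f x ord0 i.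
  by rewrite lt_neqAle f0// andbT eq_sym; apply/eqP.
pose s := \sum_i (f x ord0 i)^-1.
have s0 : 0 < s.
  rewrite /s (bigD1 ord0)//= ltr_wpDr ?invr_gt0//.
  by apply: sumr_ge0 => i _; rewrite invr_ge0 ltW.
pose xi : 'rV[R]_m.+1 := \row_i ((f x ord0 i)^-1 / s).
have xi_gt0 i : 0 < xi ord0 i by rewrite mxE divr_gt0 ?invr_gt0.
have xifx i : xi ord0 i * f x ord0 i = s^-1.
  by rewrite mxE mulrAC mulVf ?mul1r// gt_eqF.
exists xi.
  split=> [i|]; first exact: ltW.
  under eq_bigr do rewrite mxE.
  by rewrite -mulr_suml divff// gt_eqF.
split=> // y Ky; rewrite leNgt; apply/negP => /weighted_max_ltP yx.
apply: nx; exists y => // i.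
rewrite -(ltr_pM2l (xi_gt0 i)); apply: lt_le_trans (yx i) _.
by apply/weighted_max_leP => j; rewrite !xifx.
Qed.

End WeakPareto.

(** * Stability of the minimizers under perturbation of the weights *)

Section Stability.
Context (R : realType) (n m : nat).
Context (K : set 'rV[R]_n) (f : 'rV[R]_n -> 'rV[R]_m.+1).
Context (clK : closed K)
  (cK : convex_set (K : set (convex_lmodType 'rV[R]_n)))
  (fcont : {within K, continuous f})
  (qf : forall i, quasi_convex_on K (fun x => f x ord0 i)).

Lemma Theta2_connected xi : simplex xi -> connected (Theta2 K f xi).
Proof.
move=> [xi0 _]; apply/convex_connected/global_minimizers_convex => //.
exact: weighted_max_quasi_convex.
Qed.

(** A point of [D] is not a minimizer because some other point is strictly
    better, which remains true near it and near [xi]; compactness of [D] makes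
    the neighbourhood of [xi] uniform.  In other words, the set of weights whose
    minimizers meet a given compact set is closed. *)
Lemma Theta2_avoids_near D xi : compact D -> D `<=` K ->
  D `&` Theta2 K f xi = set0 ->
  \forall xi' \near xi, D `&` Theta2 K f xi' = set0.
Proof.
move=> /compact_near_coveringP Dc DK Dxi.
have loc x : D x ->
    \forall x' \near x & xi' \near xi, K x' -> ~ Theta2 K f xi' x'.
  move=> Dx; have Kx := DK x Dx.
  have [y Ky yx] : exists2 y, K y & weighted_max f xi y < weighted_max f xi x.
    apply: contrapT => ny; have : (D `&` Theta2 K f xi) x; last by rewrite Dxi.
    split=> //; split=> // y Ky; rewrite leNgt; apply/negP => yx.
    by apply: ny; exists y.
  have := weighted_max_lt_near fcont Kx Ky yx.
  apply: filterS => -[x' xi'] /= lt_yx Kx' [_ /(_ y Ky)].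
  by rewrite leNgt lt_yx.
have := Dc _ (nbhs xi) (fun xi' x => K x -> ~ Theta2 K f xi' x)
  (nbhs_filter xi) loc.
apply: filterS => xi' avoid; apply/seteqP; split=> // x [Dx].
exact: avoid Dx (DK x Dx).
Qed.

(** The strict gap between a minimizer and the compact sphere around all of
    them survives a small change of the weights, and quasi-convexity then
    confines the new minimizers to the same ball. *)
Lemma Theta2_bounded_near xi : simplex xi -> Theta2 K f xi !=set0 ->
  bounded_set (Theta2 K f xi) ->
  exists r, \forall xi' \near within (@simplex R m) (nbhs xi),
    Theta2 K f xi' !=set0 /\ Theta2 K f xi' `<=` [set x | `|x| <= r].
Proof.
move=> simpxi [x [Kx xmin]] /ex_strict_bound_gt0[r r0 Thr].
exists r.
pose S := K `&` [set z | `|z| = r].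
have Scompact : compact S.
  apply: (@compact_norm_preimage _ _ _ [set r] r clK (@closed_eq _ r)).
  by move=> _ ->; exact: lexx.
have loc z : S z -> \forall z' \near z & xi' \near xi,
    K z' -> weighted_max f xi' x < weighted_max f xi' z'.
  move=> [Kz zr]; apply: weighted_max_lt_near => //.
  rewrite ltNge; apply/negP => zx.
  have : Theta2 K f xi z by split=> // y Ky; apply: le_trans zx _; exact: xmin.
  by move/Thr => /=; rewrite zr ltxx.
move/compact_near_coveringP : Scompact => /(_ _ (nbhs xi)
  (fun xi' z => K z -> weighted_max f xi' x < weighted_max f xi' z)
  (nbhs_filter xi) loc).
apply: filterS => xi' sphere [xi'0 _].
apply: (@global_minimizers_in_ball _ _ _ _ x) => //.
- exact: weighted_max_within_continuous.
- exact: weighted_max_quasi_convex.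
- exact: Thr.
- by move=> z Kz zr; apply: sphere.
Qed.

(** Near [xi] the minimizers stay in a fixed ball, so that the part of this
    ball outside [W] is a compact set that they have to avoid. *)
Lemma Theta2_usc xi W : simplex xi -> Theta2 K f xi !=set0 ->
  bounded_set (Theta2 K f xi) -> open W -> Theta2 K f xi `<=` W ->
  \forall xi' \near within (@simplex R m) (nbhs xi), Theta2 K f xi' `<=` W.
Proof.
move=> simpxi Th0 Thb Wo ThW.
have [r near_r] := Theta2_bounded_near simpxi Th0 Thb.
pose D := K `&` [set x | `|x| <= r] `&` ~` W.
have Dcompact : compact D.
  apply: compact_closedI; last by rewrite closedC.
  by apply: (@compact_norm_preimage _ _ _ _ r clK (@closed_le _ r)).
have DTh : D `&` Theta2 K f xi = set0.
  by apply/seteqP; split=> // x [[_ nWx] /ThW].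
have DK : D `<=` K by move=> x [[]].
have near_D := Theta2_avoids_near Dcompact DK DTh.
near=> xi' => x Thx; apply: contrapT => nWx.
have [_ ler] : Theta2 K f xi' !=set0 /\ Theta2 K f xi' `<=` [set x | `|x| <= r].
  by near: xi'.
have D0 : D `&` Theta2 K f xi' = set0.
  by near: xi'; apply: filterS near_D => ? + _.
suff : (D `&` Theta2 K f xi') x by rewrite D0.
by split=> //; split=> //; split; [case: Thx|exact: ler].
Unshelve. all: by end_near.
Qed.

Lemma O2_near xi : O2 K f xi ->
  \forall xi' \near within (@simplex R m) (nbhs xi), O2 K f xi'.
Proof.
move=> [[simpxi Th0] Thb].
have [r near_r] := Theta2_bounded_near simpxi Th0 Thb.
have nr : nbhs xi [set xi' | simplex xi' ->
    Theta2 K f xi' !=set0 /\ Theta2 K f xi' `<=` [set x | `|x| <= r]] by [].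
apply: filterS nr => xi' h simpxi'; have [Th0' Thr'] := h simpxi'.
by split=> //; exact: norm_le_bounded Thr'.
Qed.

(** The weights whose minimizers meet the component form a nonempty, open and
    closed subset of the simplex. *)
Lemma connected_weak_pareto_of_bounded_component x :
  (forall i x, K x -> 0 <= f x ord0 i) ->
  weak_pareto K f x ->
  bounded_set (connected_component (weak_pareto K f) x) ->
  connected (weak_pareto K f).
Proof.
move=> f0 solx; set C := connected_component _ x => Cb.
have Csol : C `<=` weak_pareto K f by exact: connected_component_sub.
have Ccompact : compact C.
  apply: bounded_closed_compact => //.
  by apply/component_closed/closed_weak_pareto.
have CK : C `<=` K by move=> y /Csol[].
have absorb B : connected B -> B `<=` weak_pareto K f ->
    B `&` C !=set0 -> B `<=` C.
  move=> Bconn Bsol [y [By Cy]] z Bz.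
  apply: connected_component_trans Cy _.
  exact: (connected_component_max By Bsol Bconn).
have Th_sol xi : simplex xi -> Theta2 K f xi `<=` weak_pareto K f.
  by move=> simpxi y; exact: Theta2_weak_pareto.
have ThC xi : simplex xi -> C `&` Theta2 K f xi !=set0 -> Theta2 K f xi `<=` C.
  move=> simpxi meet; apply: absorb; [exact: Theta2_connected|exact: Th_sol|].
  by rewrite setIC.
pose A := [set xi | C `&` Theta2 K f xi !=set0].
have A_near xi : simplex xi -> A xi -> nbhs xi [set xi' | simplex xi' -> A xi'].
  move=> simpxi Axi.
  have O2xi : O2 K f xi.
    split; first by split=> //; case: Axi => y [_ ?]; exists y.
    exact: bounded_subset (ThC xi simpxi Axi) Cb.
  (* A ball is taken so that its intersection with the simplex is convex, hence
     connected. *)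
  have [e /= e0 ballO2] : nbhs_ball xi [set xi' | simplex xi' -> O2 K f xi'].
    by apply/nbhs_ballP; exact: O2_near.
  pose N := ball xi e `&` @simplex R m.
  have NO2 xi' : N xi' -> O2 K f xi' by move=> [/ballO2 +]; exact.
  have UC : \bigcup_(xi' in N) Theta2 K f xi' `<=` C.
    apply: absorb; last 2 first.
    - by move=> y [xi' [_ simpxi']]; exact: Th_sol.
    - case: Axi => y [Cy Thy]; exists y; split=> //; exists xi => //.
      by split=> //; exact: ballxx.
    apply: connected_bigcup_usc.
    - apply/convex_connected/convex_setI; first exact: ball_convex.
      exact: simplex_convex.
    - move=> xi' Nxi'; have [[simpxi' Th0] _] := NO2 _ Nxi'.
      by split=> //; exact: Theta2_connected.
    - move=> xi' W Nxi' Wo ThW; have [[simpxi' Th0] Thb] := NO2 _ Nxi'.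
      have usc : nbhs xi' [set s | simplex s -> Theta2 K f s `<=` W].
        exact: Theta2_usc.
      by apply: filterS usc => s + [_]; exact.
  apply/nbhs_ballP; exists e => // xi' bxi' simpxi'.
  have Nxi' : N xi' by [].
  have [[_ [y Thy]] _] := NO2 _ Nxi'.
  by exists y; split=> //; apply: UC; exists xi'.
have simplexA : @simplex R m `&` A = @simplex R m.
  apply: (convex_connected (@simplex_convex R m)).
  - have [xi simpxi Thx] := weak_pareto_Theta2 f0 solx.
    exists xi; split=> //; exists x; split=> //.
    exact: connected_component_refl.
  - exists ([set xi | simplex xi -> A xi]°); first exact: open_interior.
    apply/seteqP; split=> xi [simpxi Axi]; split=> //; first exact: A_near.
    by move/interior_subset: Axi; exact.
  - exists A => //.
    rewrite -[A]setCK closedC openE => xi nAxi.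
    have C0 : C `&` Theta2 K f xi = set0.
      by apply/seteqP; split=> // y Cy; case: nAxi; exists y.
    have := Theta2_avoids_near Ccompact CK C0.
    by apply: filterS => xi' CTh0 [y]; rewrite CTh0.
suff -> : weak_pareto K f = C by exact: component_connected.
apply/seteqP; split=> // y soly.
have [xi simpxi Thy] := weak_pareto_Theta2 f0 soly.
have [_ Axi] : (@simplex R m `&` A) xi by rewrite simplexA.
exact: ThC Thy.
Qed.

End Stability.

Theorem theorem6p1 (R : realType) (n m : nat)
    (K : set 'rV[R]_n) (f : 'rV[R]_n -> 'rV[R]_m.+1)
    (K_nonempty : K !=set0)
    (K_closed : closed K)
    (K_convex : convex_set (K : set (convex_lmodType 'rV[R]_n)))
    (f_continuous : {within K, continuous f})
    (f_quasi_convex : forall i, quasi_convex_on K (fun x => f x ord0 i))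
    (f_ge0 : forall i x, K x -> 0 <= f x ord0 i)
    (hab : connected (dom_Theta2 K f) \/
           open (O2 K f : set (subspace (@simplex R m)))) :
  (~ connected (weak_pareto K f) ->
     forall x, weak_pareto K f x ->
       ~ bounded_set (connected_component (weak_pareto K f) x)) /\
  (bounded_set (weak_pareto K f) -> connected (weak_pareto K f)).
Proof.
have connected_of_bounded x : weak_pareto K f x ->
    bounded_set (connected_component (weak_pareto K f) x) ->
    connected (weak_pareto K f).
  exact: connected_weak_pareto_of_bounded_component.
split=> [disconn x solx /(connected_of_bounded x solx)//|solb].
have [->|/set0P[x solx]] := eqVneq (weak_pareto K f) set0.
  exact: connected0.
apply: (connected_of_bounded x solx).
exact: bounded_subset (@connected_component_sub _ _ _) solb.
Qed.
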